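(* Consider a Fisher market with CES buyers, none of whom is Cobb-Douglas (i.e. $\rho_i\in[-\infty,1]\setminus\{0\}$ for all $i$). Let $\mathbf{b}^0$ be a spending matrix with all entries positive, and suppose that for every $t\ge0$ each buyer with $0<\rho_i\le1$ updates by $$b_{ij}^{t+1}=e_i\,\frac{a_{ij}\left(b_{ij}^t/p_j^t\right)^{\rho_i}}{\sum_k a_{ik}\left(b_{ik}^t/p_k^t\right)^{\rho_i}},$$ each buyer with $-\infty<\rho_i<0$ updates by $$b_{ij}^{t+1}=e_i\,\frac{\left(a_{ij}/(p_j^t)^{\rho_i}\right)^{1/(1-\rho_i)}}{\sum_k\left(a_{ik}/(p_k^t)^{\rho_i}\right)^{1/(1-\rho_i)}},$$ and each buyer with $\rho_i=-\infty$ updates by $b_{ij}^{t+1}=e_i\,\frac{c_{ij}p_j^t}{\sum_k c_{ik}p_k^t}$, where $p_j^t=\sum_i b_{ij}^t$. Let $\mathbf{b}^*$ be the spending at a market equilibrium. Then for every $T\ge1$: 1. If all buyers have substitutes utilities ($0<\rho_i\le 1$ for all $i$), then $$\Phi(\mathbf{b}^T)-\Phi(\mathbf{b}^* )\le\frac1T\sum_i\frac1{\rho_i}\mathrm{KL}(\mathbf{b}_i^*\|\mathbf{b}_i^0).$$ 2. If in addition no buyer has a linear utility ($0<\rho_i<1$ for all $i$), then with $\sigma=\min_i\{1-\rho_i\}$, $$\Phi(\mathbf{b}^T)-\Phi(\mathbf{b}^* )\le\frac{\sigma(1-\sigma)^T}{1-(1-\sigma)^T}\sum_i\frac1{\rho_i}\mathrm{KL}(\mathbf{b}_i^*\|\mathbf{b}_i^0).$$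 3. If all buyers have complementary utilities ($-\infty\le\rho_i<0$ for all $i$), then $$\Phi(\mathbf{b}^* )-\Phi(\mathbf{b}^T)\le\frac1T\sum_i\frac{\rho_i-1}{\rho_i}\mathrm{KL}(\mathbf{b}_i^*\|\mathbf{b}_i^0),$$ where $\frac{\rho_i-1}{\rho_i}:=1$ for $\rho_i=-\infty$. 4. If in addition no buyer has a Leontief utility ($-\infty<\rho_i<0$ for all $i$), then with $\sigma=\min_i\left\{\frac1{1-\rho_i}\right\}$, $$\Phi(\mathbf{b}^* )-\Phi(\mathbf{b}^T)\le\frac{\sigma(1-\sigma)^T}{1-(1-\sigma)^T}\sum_i\frac{\rho_i-1}{\rho_i}\mathrm{KL}(\mathbf{b}_i^*\|\mathbf{b}_i^0).$$
   Context: Fisher market: $n$ perfectly divisible goods with unit supply each and $m$ buyers; buyer $i$ has budget $e_i>0$ and a CES utility $u_i$ on $\mathbb{R}^n_{+}$ with parameter $\rho_i$: $u_i(\mathbf{x}_i)=\left(\sum_j a_{ij}x_{ij}^{\rho_i}\right)^{1/\rho_i}$ for finite $\rho_i\ne0$, $\rho_i\le 1$ (linear if $\rho_i=1$); $u_i(\mathbf{x}_i)=\min_j x_{ij}/c_{ij}$ (Leontief) for $\rho_i=-\infty$. Coefficients $a_{ij},c_{ij}$ are positive. A demand of buyer $i$ at prices $\mathbf{p}\in\mathbb{R}^n_{+}$ is a maximizer of $u_i$ over $\{\mathbf{x}\ge0:\mathbf{x}\cdot\mathbf{p}\le e_i\}$. A price vector $\mathbf{p}^*$ is a market equilibrium if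 there are demands $\mathbf{x}_i$ at $\mathbf{p}^*$ with $\sum_i x_{ij}=1$ whenever $p^*_j>0$ and $\sum_i x_{ij}\le1$ whenever $p_j^*=0$; the equilibrium spending is $b^*_{ij}=x_{ij}p^*_j$. A spending matrix is $\mathbf{b}=(b_{ij})$ with $b_{ij}\ge0$, $\sum_j b_{ij}=e_i$; $\mathbf{b}_i$ is its $i$-th row; $p_j(\mathbf{b})=\sum_i b_{ij}$. $\mathrm{KL}(\mathbf{x}\|\mathbf{y})=\sum_j x_j\ln(x_j/y_j)$. The potential function is $$\Phi(\mathbf{b})=-\sum_{i:\rho_i\ne-\infty}\frac1{\rho_i}\sum_j b_{ij}\log\frac{a_{ij}b_{ij}^{\rho_i-1}}{p_j(\mathbf{b})^{\rho_i}}-\sum_{i:\rho_i=-\infty}\sum_j b_{ij}\log\frac{b_{ij}}{c_{ij}p_j(\mathbf{b})}.$$ Logarithms are natural, and terms with $b_{ij}=0$ (or $x_j=0$) are read as $0$. *)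

(* Defs.v *)
From mathcomp Require Import all_boot all_order all_algebra.
From mathcomp Require Import all_classical all_reals all_analysis.

Set Implicit Arguments.
Unset Strict Implicit.
Unset Printing Implicit Defensive.

Import Order.TTheory GRing.Theory Num.Theory.

Local Open Scope ring_scope.

(* Buyers are indexed by 'I_m and goods by 'I_n.  The CES parameters are
   extended reals; -oo encodes a Leontief buyer, and +oo is always excluded by
   the hypothesis rho i <= 1, so that the values given to it below are
   irrelevant. *)

(* For r < 0 the usual conventions 0^r = +oo and (+oo)^(1/r) = 0 make the
   utility vanish as soon as one coordinate does; this is a separate case
   because 0 `^ r = 0 in the library.  The Leontief minimum is taken in \bar R
   so that +oo is a neutral element. *)
Definition ces_utility (R : realType) (n : nat) (rho : \bar R)
    (a c x : 'rV[R]_n) : \bar R :=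
  match rho with
  | r%:E =>
      (if (r < 0) && [exists j, x 0 j == 0] then 0
       else (\sum_j a 0 j * x 0 j `^ r) `^ r^-1)%:E
  | -oo%E => \big[Order.min/+oo%E]_(j < n) (x 0 j / c 0 j)%:E
  | +oo%E => 0%E
  end.

Definition affordable (R : realType) (n : nat) (e : R) (p x : 'rV[R]_n) : Prop :=
  (forall j, 0 <= x 0 j) /\ \sum_j x 0 j * p 0 j <= e.

Definition is_demand (R : realType) (n : nat) (u : 'rV[R]_n -> \bar R) (e : R)
    (p x : 'rV[R]_n) : Prop :=
  affordable e p x /\ forall y, affordable e p y -> (u y <= u x)%E.

Definition market_equilibrium (R : realType) (m n : nat) (e : 'I_m -> R)
    (rho : 'I_m -> \bar R) (a c : 'M[R]_(m, n))
    (p : 'rV[R]_n) (x : 'M[R]_(m, n)) : Prop :=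
  [/\ forall j, 0 <= p 0 j,
      forall i, is_demand (ces_utility (rho i) (row i a) (row i c)) (e i) p
                  (row i x),
      forall j, 0 < p 0 j -> \sum_i x i j = 1 &
      forall j, p 0 j = 0 -> \sum_i x i j <= 1].

Definition equilibrium_spending (R : realType) (m n : nat) (e : 'I_m -> R)
    (rho : 'I_m -> \bar R) (a c b : 'M[R]_(m, n)) : Prop :=
  exists p x, market_equilibrium e rho a c p x /\
    forall i j, b i j = x i j * p 0 j.

Definition spending_matrix (R : realType) (m n : nat) (e : 'I_m -> R)
    (b : 'M[R]_(m, n)) : Prop :=
  (forall i j, 0 <= b i j) /\ forall i, \sum_j b i j = e i.

Definition prices (R : realType) (m n : nat) (b : 'M[R]_(m, n)) : 'rV[R]_n :=
  \row_j \sum_i b i j.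

(* In KL and potential, a term with x 0 j = 0 or b i j = 0 is 0 whatever the
   value of the logarithm. *)
Definition KL (R : realType) (n : nat) (x y : 'rV[R]_n) : R :=
  \sum_j x 0 j * ln (x 0 j / y 0 j).

Definition potential (R : realType) (m n : nat) (rho : 'I_m -> \bar R)
    (a c b : 'M[R]_(m, n)) : R :=
  let p := prices b in
  - \sum_(i | rho i != -oo%E)
      (fine (rho i))^-1 *
      \sum_j b i j * ln (a i j * b i j `^ (fine (rho i) - 1)
                         / p 0 j `^ fine (rho i))
  - \sum_(i | rho i == -oo%E) \sum_j b i j * ln (b i j / (c i j * p 0 j)).

(* Unnormalized next-round bid of a buyer. *)
Definition bid_weight (R : realType) (m n : nat) (rho : 'I_m -> \bar R)
    (a c b : 'M[R]_(m, n)) (i : 'I_m) (j : 'I_n) : R :=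
  let p := prices b in
  match rho i with
  | r%:E => if 0 < r then a i j * (b i j / p 0 j) `^ r
            else (a i j / p 0 j `^ r) `^ (1 - r)^-1
  | -oo%E => c i j * p 0 j
  | +oo%E => 0
  end.

Definition bid_update (R : realType) (m n : nat) (e : 'I_m -> R)
    (rho : 'I_m -> \bar R) (a c b : 'M[R]_(m, n)) : 'M[R]_(m, n) :=
  \matrix_(i, j) (e i * (bid_weight rho a c b i j
                         / \sum_k bid_weight rho a c b i k)).

(* (rho - 1) / rho, extended to the Leontief case by its limit. *)
Definition complement_coef (R : realType) (rho : \bar R) : R :=
  if rho is r%:E then (r - 1) / r else 1.

(* Main.v *)
(* Up to sign, the potential is mirror_objective, whose Bregman divergence is
   a sum of KL terms on the rows plus or minus a KL term on the prices.  By the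
   log-sum inequality the price term lies between 0 and the sum of the row
   terms, so that the potential is smooth and (strongly) convex relative to a
   weighted sum of row divergences.  The bid update is exactly a mirror descent
   step for that weighted divergence, and the three-point inequality telescopes.
   The comparison point may be any spending matrix; equilibrium is only used
   to see that demands exhaust the budgets. *)

Require Import Defs.
From mathcomp Require Import all_boot all_order all_algebra.
From mathcomp Require Import ring lra.
From mathcomp Require Import all_classical all_reals all_analysis.

Set Implicit Arguments.
Unset Strict Implicit.
Unset Printing Implicit Defensive.

Import Order.TTheory GRing.Theory Num.Theory.

Local Open Scope ring_scope.

(** * Kullback-Leibler divergence and the log-sum inequality *)

Section Divergence.
Variable R : realType.

Lemma mulr_ln_div (x y : R) :
  0 <= x -> (0 < x -> 0 < y) -> x * ln (x / y) = x * (ln x - ln y).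
Proof.
rewrite le_eqVlt => /predU1P[<-|x0] xy; first by rewrite !mul0r.
by rewrite ln_div ?posrE ?xy.
Qed.

(** This is ln (1 + z) <= z at z = y / x - 1, multiplied by [x]. *)
Lemma subr_le_mulr_ln (x y : R) : 0 <= x -> 0 < y -> x - y <= x * ln (x / y).
Proof.
rewrite le_eqVlt => /predU1P[<-|x0] y0; first by rewrite mul0r; lra.
have yx0 : 0 < y / x by rewrite divr_gt0.
have /le_ln1Dx : -1 < y / x - 1 by lra.
rewrite addrC subrK ln_div ?posrE// => le_ln.
rewrite mulr_ln_div; [|lra|by []].
have := ler_wpM2l (ltW x0) le_ln.
rewrite !mulrBr mulr1 mulrCA divff ?gt_eqF// mulr1; lra.
Qed.

Lemma KLE n (x y : 'rV[R]_n) : (forall j, 0 <= x 0 j) ->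
  (forall j, 0 < x 0 j -> 0 < y 0 j) ->
  KL x y = \sum_j x 0 j * (ln (x 0 j) - ln (y 0 j)).
Proof. by move=> x0 xy; apply: eq_bigr => j _; apply: mulr_ln_div (x0 j) (xy j). Qed.

(** The linear lower bounds of [subr_le_mulr_ln] cancel in the sum because the totals agree. *)
Lemma KL_ge0 n (x y : 'rV[R]_n) : (forall j, 0 <= x 0 j) ->
  (forall j, 0 < y 0 j) -> \sum_j x 0 j = \sum_j y 0 j -> 0 <= KL x y.
Proof.
move=> x0 y0 xy.
have -> : 0 = \sum_j (x 0 j - y 0 j) by rewrite sumrB xy subrr.
by apply: ler_sum => j _; apply: subr_le_mulr_ln.
Qed.

Lemma KLxx n (x : 'rV[R]_n) : KL x x = 0.
Proof.
rewrite /KL big1// => j _; have [->|xj0] := eqVneq (x 0 j) 0.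
  by rewrite mul0r.
by rewrite divff// ln1 mulr0.
Qed.

(** Rescaling [y] by the ratio [l] of the totals makes them equal. Then [subr_le_mulr_ln], applied
    to each [x i] and [y i * l], has linear terms that sum to 0. *)
Lemma log_sum_inequality (I : finType) (x y : I -> R) :
  (forall i, 0 <= x i) -> (forall i, 0 < y i) ->
  (\sum_i x i) * ln ((\sum_i x i) / \sum_i y i) <=
  \sum_i x i * ln (x i / y i).
Proof.
move=> x0 y0; have sx0 : 0 <= \sum_i x i by apply: sumr_ge0.
have [sx|sx] := eqVneq (\sum_i x i) 0.
  rewrite sx mul0r big1// => i _.
  by rewrite (psumr_eq0P (fun i _ => x0 i) sx) ?mul0r.
have {}sx0 : 0 < \sum_i x i by rewrite lt_def sx sx0.
(* [I] may be empty, but a nonzero sum of [x] provides an index. *)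
have sy0 : 0 < \sum_i y i.
  have /existsP[i _] : [exists i, x i != 0].
    apply: contra_neqT sx; rewrite negb_exists => /forallP h.
    by rewrite big1// => i _; apply/eqP; rewrite -[_ == _]negbK h.
  rewrite (bigD1 i)//= ltr_pwDl// sumr_ge0// => k _; exact: ltW.
set l := (\sum_i x i) / \sum_i y i.
have l0 : 0 < l by rewrite divr_gt0.
have -> : (\sum_i x i) * ln l = \sum_i (x i * ln l + (x i - y i * l)).
  rewrite big_split/= sumrB -!mulr_suml /l mulrCA divff ?gt_eqF//.
  by rewrite mulr1 subrr addr0.
clearbody l; apply: ler_sum => i _.
have yl0 := mulr_gt0 (y0 i) l0.
have := subr_le_mulr_ln (x0 i) yl0.
rewrite (mulr_ln_div (x0 i) (fun=> yl0)) (mulr_ln_div (x0 i) (fun=> y0 i)).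
rewrite lnM ?posrE//; lra.
Qed.

Lemma prices_ge0 m n (y : 'M[R]_(m, n)) j :
  (forall i j, 0 <= y i j) -> 0 <= prices y 0 j.
Proof. by move=> y0; rewrite mxE sumr_ge0. Qed.

Lemma prices_ord_gt0 m n (w : 'M[R]_(m, n)) (i : 'I_m) j :
  (forall i j, 0 < w i j) -> 0 < prices w 0 j.
Proof.
move=> w0; rewrite mxE (bigD1 i)//= ltr_pwDl// sumr_ge0// => k _; exact: ltW.
Qed.

(** All prices vanish when there are no buyers, so the positive price under [y] serves to exhibit
    one. *)
Lemma prices_gt0 m n (y w : 'M[R]_(m, n)) j : (forall i j, 0 < w i j) ->
  0 < prices y 0 j -> 0 < prices w 0 j.
Proof.
case: m y w => [y w _|m y w w0 _]; first by rewrite !mxE !big_ord0 ltxx.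
exact: prices_ord_gt0 ord0 _ w0.
Qed.

(** For each good, this is the log-sum inequality over the buyers. *)
Lemma KL_prices_le m n (y w : 'M[R]_(m, n)) : (forall i j, 0 <= y i j) ->
  (forall i j, 0 < w i j) ->
  KL (prices y) (prices w) <= \sum_i KL (row i y) (row i w).
Proof.
move=> y0 w0; rewrite /KL exchange_big; apply: ler_sum => j _.
under [leRHS]eq_bigr do rewrite !mxE.
by rewrite !mxE; apply: log_sum_inequality.
Qed.

(** Both price vectors have the sum of the budgets as their total. *)
Lemma KL_prices_ge0 m n (e : 'I_m -> R) (y w : 'M[R]_(m, n)) :
  spending_matrix e y -> spending_matrix e w -> (forall i j, 0 < w i j) ->
  0 <= KL (prices y) (prices w).
Proof.
case: m e y w => [|m] e y w [y0 ye] [_ we] w0.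
  by rewrite /KL big1// => j _; rewrite mxE big_ord0 mul0r.
apply: KL_ge0 => [j|j|]; [exact: prices_ge0|exact: prices_ord_gt0 ord0 _ w0|].
under eq_bigr do rewrite mxE; under [RHS]eq_bigr do rewrite mxE.
rewrite exchange_big [RHS]exchange_big.
by apply: eq_bigr => i _ /=; rewrite ye we.
Qed.

Lemma KL_row_ge0 m n (e : 'I_m -> R) (y w : 'M[R]_(m, n)) i :
  spending_matrix e y -> spending_matrix e w -> (forall i j, 0 < w i j) ->
  0 <= KL (row i y) (row i w).
Proof.
move=> [y0 ye] [_ we] w0; apply: KL_ge0 => [j|j|]; rewrite ?mxE//.
under eq_bigr do rewrite mxE; under [RHS]eq_bigr do rewrite mxE.
by rewrite ye we.
Qed.

End Divergence.

(** * Mirror descent with weighted row divergences *)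

Section MirrorDescent.
Variables (R : realType) (m n : nat) (e : 'I_m -> R).
Variables (alpha beta : 'I_m -> R) (g : 'M[R]_(m, n)) (s : R).

(** The partial derivative of [mirror_objective] without its summand [alpha i + s]. That summand is
    constant along a row, hence irrelevant between matrices with the same row sums. *)
Definition mirror_gradient (w : 'M[R]_(m, n)) i j : R :=
  alpha i * ln (w i j) - g i j + s * ln (prices w 0 j).

Definition mirror_objective (w : 'M[R]_(m, n)) : R :=
  \sum_i \sum_j w i j * mirror_gradient w i j.

Definition mirror_divergence (y w : 'M[R]_(m, n)) : R :=
  \sum_i alpha i * KL (row i y) (row i w) + s * KL (prices y) (prices w).

Definition mirror_distance (y w : 'M[R]_(m, n)) : R :=
  \sum_i beta i * KL (row i y) (row i w).

(* The objective is homogeneous up to a linear term, so that its Bregman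
   divergence is exactly [mirror_divergence]. *)
Lemma mirror_objective_expansion (y w : 'M[R]_(m, n)) :
  (forall i j, 0 <= y i j) -> (forall i j, 0 < w i j) ->
  mirror_objective y =
  \sum_i \sum_j y i j * mirror_gradient w i j + mirror_divergence y w.
Proof.
move=> y0 w0; rewrite /mirror_divergence KLE; last 2 first.
- by move=> j; exact: prices_ge0.
- by move=> j; exact: prices_gt0.
have -> : \sum_j prices y 0 j * (ln (prices y 0 j) - ln (prices w 0 j)) =
    \sum_i \sum_j y i j * (ln (prices y 0 j) - ln (prices w 0 j)).
  rewrite exchange_big; apply: eq_bigr => j _.
  by rewrite -mulr_suml; congr (_ * _); rewrite mxE.
rewrite mulr_sumr -!big_split; apply: eq_bigr => i _ /=.
rewrite KLE; last 2 first.
- by move=> j; rewrite mxE.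
- by move=> j; rewrite !mxE.
rewrite !mulr_sumr -!big_split; apply: eq_bigr => j _ /=.
rewrite /mirror_gradient [row i y 0 j]mxE [row i w 0 j]mxE; ring.
Qed.

(** First-order optimality of [w'] for the linearization at [w] plus [mirror_distance] to [w]. The
    row constant [k i] absorbs the Lagrange multiplier of the budget constraint. *)
Definition mirror_step (w w' : 'M[R]_(m, n)) : Prop :=
  exists k : 'I_m -> R, forall i j,
    beta i * (ln (w' i j) - ln (w i j)) + mirror_gradient w i j = k i.

Lemma mirror_three_point (y w w' : 'M[R]_(m, n)) :
  spending_matrix e y -> spending_matrix e w' -> (forall i j, 0 < w i j) ->
  (forall i j, 0 < w' i j) -> mirror_step w w' ->
  mirror_divergence w' w <= mirror_distance w' w ->
  mirror_objective w' - mirror_objective y <=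
  mirror_distance y w - mirror_divergence y w - mirror_distance y w'.
Proof.
move=> ye w'e w0 w'0 [k wk] smooth.
(* The step condition turns the pairing with the gradient into a difference of distances. The
   remaining constant is the same for every [z] because the row sums are fixed, so it cancels
   between [w'] and [y]. *)
have lin z : spending_matrix e z ->
    \sum_i \sum_j z i j * mirror_gradient w i j =
    \sum_i e i * k i + mirror_distance z w' - mirror_distance z w.
  move=> [z0 ze]; rewrite -big_split -sumrB; apply: eq_bigr => i _ /=.
  rewrite !KLE; try by move=> j; rewrite !mxE.
  rewrite -ze mulr_suml !mulr_sumr -big_split -sumrB; apply: eq_bigr => j _ /=.
  rewrite [row i z 0 j]mxE [row i w 0 j]mxE [row i w' 0 j]mxE -(wk i j); ring.
have w'w' : mirror_distance w' w' = 0.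
  by rewrite /mirror_distance big1// => i _; rewrite KLxx mulr0.
rewrite !(mirror_objective_expansion _ w0) ?lin//.
- rewrite w'w'; lra.
- by case: ye.
- by case: w'e.
Qed.

End MirrorDescent.

(** * From one-step inequalities to convergence rates *)

(** Step [t] gets weight q^(T-1-t), which makes the distances telescope; monotonicity of [f] then
    replaces every intermediate value by the last one. *)
Lemma weighted_telescope (R : realType) (q f0 : R) (f d : nat -> R) (T : nat) :
  0 <= q -> (forall t, 0 <= d t) -> (forall t, f t.+1 <= f t) ->
  (forall t, f t.+1 - f0 <= q * d t - d t.+1) ->
  (\sum_(k < T) q ^+ k) * (f T - f0) <= q ^+ T * d 0%N - d T.
Proof.
move=> q0 d0 decr step; elim: T => [|T IH].
  by rewrite big_ord0 mul0r mul1r subrr.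
have sE : \sum_(k < T.+1) q ^+ k = 1 + q * \sum_(k < T) q ^+ k.
  rewrite big_ord_recl expr0 mulr_sumr; congr (_ + _).
  by apply: eq_bigr => k _; rewrite -exprS.
have S0 : 0 <= q * \sum_(k < T) q ^+ k.
  by rewrite mulr_ge0// sumr_ge0// => k _; rewrite exprn_ge0.
have h1 := ler_wpM2l S0 (decr T).
have h2 := ler_wpM2l q0 IH.
rewrite sE exprS.
have := step T; lra.
Qed.

(** The upper bound on the divergence is relative smoothness and validates each step. The lower
    bound is relative strong convexity and contracts the distance by [1 - sigma]; plain convexity is
    the case [sigma = 0]. *)
Lemma mirror_descent_rate (R : realType) m n (e alpha beta : 'I_m -> R)
    (g : 'M[R]_(m, n)) (s sigma : R) (b : nat -> 'M[R]_(m, n))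
    (y : 'M[R]_(m, n)) (T : nat) :
  sigma <= 1 -> (forall i, 0 <= beta i) -> spending_matrix e y ->
  (forall t, spending_matrix e (b t)) -> (forall t i j, 0 < b t i j) ->
  (forall t, mirror_step alpha beta g s (b t) (b t.+1)) ->
  (forall z w : 'M[R]_(m, n), spending_matrix e z -> spending_matrix e w ->
    (forall i j, 0 < w i j) ->
    sigma * mirror_distance beta z w <= mirror_divergence alpha s z w <=
    mirror_distance beta z w) ->
  (\sum_(k < T) (1 - sigma) ^+ k) *
    (mirror_objective alpha g s (b T) - mirror_objective alpha g s y) <=
  (1 - sigma) ^+ T * mirror_distance beta y (b 0%N).
Proof.
move=> sigma1 beta0 ye be b0 step rel.
have dist0 (z : 'M[R]_(m, n)) t : spending_matrix e z -> 0 <= mirror_distance beta z (b t).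
  move=> ze; apply: sumr_ge0 => i _; apply: mulr_ge0 => //.
  exact: KL_row_ge0 ze (be t) (b0 t).
have descent (z : 'M[R]_(m, n)) t : spending_matrix e z ->
    mirror_objective alpha g s (b t.+1) - mirror_objective alpha g s z <=
    (1 - sigma) * mirror_distance beta z (b t) - mirror_distance beta z (b t.+1).
  move=> ze; have /andP[_ up] := rel _ _ (be t.+1) (be t) (b0 t).
  have /andP[lo _] := rel _ _ ze (be t) (b0 t).
  have := mirror_three_point ze (be t.+1) (b0 t) (b0 t.+1) (step t) up; lra.
have self t : mirror_distance beta (b t) (b t) = 0.
  by rewrite /mirror_distance big1// => i _; rewrite KLxx mulr0.
(* Monotonicity comes from taking the current iterate as the comparison point. *)
have decr t :
    mirror_objective alpha g s (b t.+1) <= mirror_objective alpha g s (b t).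
  have := descent (b t) t (be t); rewrite self mulr0.
  have := dist0 (b t) t.+1 (be t); lra.
have q0 : 0 <= 1 - sigma by lra.
have := weighted_telescope (f := fun t => mirror_objective alpha g s (b t))
  (d := fun t => mirror_distance beta y (b t)) T q0 (fun t => dist0 y t ye)
  decr (fun t => descent y t ye).
have := dist0 y T ye; rewrite /=; lra.
Qed.

(** The case [sigma = 0] of [mirror_descent_rate], with [1 - 0] left unsimplified to match it: all
    weights are 1 and add up to [T]. *)
Lemma sublinear_rate (R : realFieldType) (T : nat) (f d : R) : (1 <= T)%N ->
  (\sum_(k < T) (1 - 0) ^+ k) * f <= (1 - 0) ^+ T * d -> f <= T%:R^-1 * d.
Proof.
move=> T1; under eq_bigr do rewrite subr0 expr1n.
rewrite sumr_const card_ord subr0 expr1n mul1r => h.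
by rewrite mulrC ler_pdivlMr ?ltr0n// mulrC.
Qed.

(** The geometric sum equals (1 - (1 - sigma)^T) / sigma, and [1 <= T] keeps its numerator
    positive. *)
Lemma linear_rate (R : realFieldType) (T : nat) (sigma f d : R) : (1 <= T)%N ->
  0 < sigma <= 1 ->
  (\sum_(k < T) (1 - sigma) ^+ k) * f <= (1 - sigma) ^+ T * d ->
  f <= sigma * (1 - sigma) ^+ T / (1 - (1 - sigma) ^+ T) * d.
Proof.
move=> T1 /andP[s0 s1] h.
have q1 : (1 - sigma) ^+ T < 1 by rewrite exprn_ilt1 -?lt0n//; lra.
rewrite mulrAC ler_pdivlMr ?subr_gt0//.
have -> : 1 - (1 - sigma) ^+ T = sigma * \sum_(k < T) (1 - sigma) ^+ k.
  by rewrite -opprB subrX1 -mulNr opprB; congr (_ * _); lra.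
by rewrite mulrCA -mulrA (ler_pM2l s0) mulrC.
Qed.

(** * CES demands spend the whole budget *)

Section Demand.
Variables (R : realType) (n : nat).
Implicit Types (a c x p : 'rV[R]_n) (rho : \bar R) (l : R).

(** The outer exponent 1/r undoes the factor l^r, and scaling keeps the set of zero coordinates. For
    Leontief, multiplication by [l > 0] commutes with the minimum and fixes +oo. *)
Lemma ces_utilityZ rho a c x l : rho != 0%E -> rho != +oo%E ->
  (forall j, 0 <= a 0 j) -> (forall j, 0 <= x 0 j) -> 0 < l ->
  ces_utility rho a c (l *: x) = (l%:E * ces_utility rho a c x)%E.
Proof.
case: rho => [r| |] r0 ry a0 x0 l0; have l0' := ltW l0; rewrite /ces_utility.
- have {}r0 : r != 0 by move: r0; rewrite eqe.
  have -> : [exists j, (l *: x) 0 j == 0] = [exists j, x 0 j == 0].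
    by apply: eq_existsb => j; rewrite mxE mulf_eq0 gt_eqF.
  rewrite -EFinM; congr (_%:E).
  case: (_ && _); first by rewrite mulr0.
  under eq_bigr => j _ do rewrite mxE (powRM r l0' (x0 j)) mulrCA.
  rewrite -mulr_sumr powRM ?powR_ge0//; last first.
    by apply: sumr_ge0 => j _; rewrite mulr_ge0// powR_ge0.
  rewrite -powRrM divff// powRr1//.
- by rewrite eqxx in ry.
- rewrite (big_endo (fun z => l%:E * z)%E).
  + by apply: eq_bigr => j _; rewrite mxE -mulrA EFinM.
  + by move=> u v; rewrite mine_pMr// lee_fin.
  + by rewrite gt0_muley.
Qed.

Lemma ces_utility_gt0 rho a c x : (0 < n)%N -> rho != +oo%E ->
  (forall j, 0 < a 0 j) -> (forall j, 0 < c 0 j) -> (forall j, 0 < x 0 j) ->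
  (0 < ces_utility rho a c x)%E.
Proof.
case: n a c x => // k a c x _; case: rho => [r||] //= _ a0 c0 x0.
  rewrite ifF; last first.
    apply/negbTE; rewrite negb_and negb_exists; apply/orP; right.
    by apply/forallP => j; rewrite gt_eqF.
  rewrite lte_fin powR_gt0// (bigD1 ord0)//= ltr_pwDl//.
    by rewrite mulr_gt0// powR_gt0.
  by apply: sumr_ge0 => j _; rewrite mulr_ge0 ?powR_ge0 ?ltW.
by apply: lt_bigmin => [|j _]; rewrite ?ltry// lte_fin divr_gt0.
Qed.

(** With at least one good, the Leontief minimum is below a real ratio instead of being its neutral
    element +oo. *)
Lemma ces_utility_lty rho a c x : (0 < n)%N ->
  (ces_utility rho a c x < +oo)%E.
Proof.
case: n a c x => // k a c x _; case: rho => [r||] /=; rewrite ?ltry//.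
by apply: le_lt_trans (bigmin_le _ ord0 _) _; rewrite ltry.
Qed.

(* The utility is positive at the demand and homogeneous, so that an unspent
   amount could be used to scale the demand up. *)
Lemma demand_exhausts_budget rho a c p x l : (0 < n)%N ->
  rho != 0%E -> rho != +oo%E ->
  (forall j, 0 < a 0 j) -> (forall j, 0 < c 0 j) -> (forall j, 0 <= p 0 j) ->
  0 < l -> is_demand (ces_utility rho a c) l p x ->
  \sum_j x 0 j * p 0 j = l.
Proof.
move=> n0 r0 ry a0 c0 p0 l0 [[x0 xl] opt].
set S := \sum_j x 0 j * p 0 j in xl *.
have S0 : 0 <= S by apply: sumr_ge0 => j _; rewrite mulr_ge0.
have u0 : (0 < ces_utility rho a c x)%E.
  have P0 : 0 <= \sum_j p 0 j by apply: sumr_ge0.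
  have d0 : 0 < l / (1 + \sum_j p 0 j) by rewrite divr_gt0// ltr_pwDl.
  (* An affordable bundle with all entries positive; the added 1 keeps the denominator positive even
     if all prices vanish. *)
  pose y : 'rV[R]_n := const_mx (l / (1 + \sum_j p 0 j)).
  apply: lt_le_trans (ces_utility_gt0 (x := y) n0 ry a0 c0 _) (opt y _).
    by move=> j; rewrite mxE.
  split=> [j|]; first by rewrite mxE ltW.
  under eq_bigr do rewrite mxE.
  rewrite -mulr_sumr mulrAC ler_pdivrMr ?ltr_pwDl//.
  by rewrite ler_pM2l// lerDr.
apply/eqP; rewrite eq_le xl leNgt; apply/negP => Sl.
(* This factor exceeds 1 because [S < l], and the scaled bundle costs 2lS / (l + S) <= l. It also
   avoids dividing by [S], which may be 0. *)
have k1 : 1 < 2 * l / (l + S) by rewrite ltr_pdivlMr; lra.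
have k0 : 0 < 2 * l / (l + S) by lra.
have := opt (2 * l / (l + S) *: x); rewrite ces_utilityZ//; last first.
  by move=> j; exact: ltW.
have := ces_utility_lty rho a c x n0.
case: (ces_utility rho a c x) u0 => [u| |] //; rewrite lte_fin => u0 _ h.
have : affordable l p (2 * l / (l + S) *: x).
  split=> [j|]; first by rewrite mxE mulr_ge0// ltW.
  under eq_bigr do rewrite mxE -mulrA.
  rewrite -mulr_sumr -/S mulrAC ler_pdivrMr; nra.
by move=> /h; rewrite -EFinM lee_fin; nra.
Qed.

End Demand.

Lemma equilibrium_spending_matrix (R : realType) m n (e : 'I_m -> R)
    (rho : 'I_m -> \bar R) (a c y : 'M[R]_(m, n)) : (0 < n)%N ->
  (forall i, 0 < e i) -> (forall i, rho i != 0%E) ->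
  (forall i, rho i != +oo%E) ->
  (forall i j, 0 < a i j) -> (forall i j, 0 < c i j) ->
  equilibrium_spending e rho a c y -> spending_matrix e y.
Proof.
move=> n0 e0 r0 ry a0 c0 [p [x [[p0 dem _ _] yE]]]; split=> [i j|i].
  rewrite yE mulr_ge0//; have [[/(_ j)]] := dem i; by rewrite mxE.
have <- := demand_exhausts_budget n0 (r0 i) (ry i) _ _ p0 (e0 i) (dem i).
- by apply: eq_bigr => j _; rewrite yE mxE.
- by move=> j; rewrite mxE.
- by move=> j; rewrite mxE.
Qed.

(** * The bid update as a mirror step, and the potential as a mirror objective *)

Section BidDynamics.
Variables (R : realType) (m n : nat) (e : 'I_m -> R) (rho : 'I_m -> \bar R).
Variables (a c : 'M[R]_(m, n)).
Hypotheses (n0 : (0 < n)%N) (e0 : forall i, 0 < e i).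
Hypotheses (rhoy : forall i, rho i != +oo%E).
Hypotheses (a0 : forall i j, 0 < a i j) (c0 : forall i j, 0 < c i j).

Lemma bid_weight_gt0 (w : 'M[R]_(m, n)) i j : (forall i j, 0 < w i j) ->
  0 < bid_weight rho a c w i j.
Proof.
move=> w0; have p0 := prices_ord_gt0 i j w0.
rewrite /bid_weight; case: (rho i) (rhoy i) => [r| |] // _.
  by case: ifP => _; rewrite ?mulr_gt0 ?powR_gt0 ?divr_gt0 ?powR_gt0.
by rewrite mulr_gt0.
Qed.

Lemma sum_bid_weight_gt0 (w : 'M[R]_(m, n)) i : (forall i j, 0 < w i j) ->
  0 < \sum_j bid_weight rho a c w i j.
Proof.
move=> w0; rewrite (bigD1 (Ordinal n0))//= ltr_pwDl ?bid_weight_gt0//.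
by apply: sumr_ge0 => j _; rewrite ltW// bid_weight_gt0.
Qed.

Lemma bid_update_gt0 (w : 'M[R]_(m, n)) i j : (forall i j, 0 < w i j) ->
  0 < bid_update e rho a c w i j.
Proof.
move=> w0.
by rewrite mxE mulr_gt0// divr_gt0 ?bid_weight_gt0 ?sum_bid_weight_gt0.
Qed.

Lemma bid_update_spending (w : 'M[R]_(m, n)) : (forall i j, 0 < w i j) ->
  spending_matrix e (bid_update e rho a c w).
Proof.
move=> w0; split=> [i j|i]; first by rewrite ltW// bid_update_gt0.
under eq_bigr do rewrite mxE.
by rewrite -mulr_sumr -mulr_suml divff ?mulr1// gt_eqF ?sum_bid_weight_gt0.
Qed.

Lemma ln_bid_update (w : 'M[R]_(m, n)) i j : (forall i j, 0 < w i j) ->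
  ln (bid_update e rho a c w i j) =
  ln (bid_weight rho a c w i j) +
  (ln (e i) - ln (\sum_k bid_weight rho a c w i k)).
Proof.
move=> w0; have W0 := bid_weight_gt0 i j w0; have S0 := sum_bid_weight_gt0 i w0.
rewrite mxE lnM ?posrE ?divr_gt0// ln_div ?posrE//; ring.
Qed.

(** Normalizing the weights shifts their logarithms by a constant on each row, which goes into
    [k i]. Thus optimality can be checked on the unnormalized weights. *)
Lemma mirror_step_bid_update (alpha beta : 'I_m -> R) (g : 'M[R]_(m, n))
    (s : R) (w : 'M[R]_(m, n)) : (forall i j, 0 < w i j) ->
  (forall i j, beta i * (ln (bid_weight rho a c w i j) - ln (w i j)) +
    mirror_gradient alpha g s w i j = 0) ->
  mirror_step alpha beta g s w (bid_update e rho a c w).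
Proof.
move=> w0 opt; exists (fun i => beta i *
  (ln (e i) - ln (\sum_k bid_weight rho a c w i k))) => i j.
rewrite ln_bid_update// -[RHS]addr0 -(opt i j); ring.
Qed.

(** A zero bid kills its term on both sides; a positive bid forces a positive price, so the
    logarithm splits. *)
Lemma potentialE (y : 'M[R]_(m, n)) : (forall i j, 0 <= y i j) ->
  potential rho a c y = - \sum_i \sum_j y i j *
    if rho i == -oo%E then ln (y i j) - ln (c i j) - ln (prices y 0 j)
    else (fine (rho i))^-1 *
      (ln (a i j) + (fine (rho i) - 1) * ln (y i j)
       - fine (rho i) * ln (prices y 0 j)).
Proof.
move=> y0; rewrite /potential -opprD; congr (- _).
rewrite big_mkcond [X in _ + X]big_mkcond -big_split; apply: eq_bigr => i _ /=.
have y_le_prices j : y i j <= prices y 0 j.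
  by rewrite mxE (bigD1 i)//= lerDl sumr_ge0.
case: eqVneq => _; rewrite ?add0r ?addr0 ?mulr_sumr; apply: eq_bigr => j _.
  have := y0 i j; rewrite le_eqVlt => /predU1P[<-|yij0]; first by rewrite !mul0r.
  have pj0 := lt_le_trans yij0 (y_le_prices j).
  by rewrite ln_div ?posrE ?mulr_gt0// lnM ?posrE// opprD addrA.
rewrite [RHS]mulrCA; congr (_ * _).
have := y0 i j; rewrite le_eqVlt => /predU1P[<-|yij0]; first by rewrite !mul0r.
have pj0 := lt_le_trans yij0 (y_le_prices j).
by rewrite ln_div ?posrE ?mulr_gt0 ?powR_gt0// lnM ?posrE ?powR_gt0// !ln_powR.
Qed.

(** * Convergence rates for substitutes and for complements *)

Section Trajectory.
Variables (b : nat -> 'M[R]_(m, n)) (y : 'M[R]_(m, n)).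
Hypotheses (b0_spending : spending_matrix e (b 0%N)).
Hypotheses (b0_gt0 : forall i j, 0 < b 0%N i j).
Hypotheses (b_update : forall t, b t.+1 = bid_update e rho a c (b t)).
Hypotheses (ye : spending_matrix e y).

Lemma bid_gt0 t i j : 0 < b t i j.
Proof.
elim: t i j => [|t IH] i j; first exact: b0_gt0.
by rewrite b_update bid_update_gt0.
Qed.

Lemma bid_spending t : spending_matrix e (b t).
Proof.
case: t => [//|t]; rewrite b_update; apply: bid_update_spending.
exact: bid_gt0.
Qed.

(** Here [s = 1]. Dropping the nonnegative price divergence gives the lower bound, since
    [alpha i = (1 - rho i) * beta i]. Bounding it by the row divergences gives the upper one, since
    [alpha i + 1 = beta i]. *)
Lemma substitutes_rate (sigma : R) (T : nat) : (forall i, (0 < rho i)%E) ->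
  0 <= sigma <= 1 -> (forall i, sigma <= 1 - fine (rho i)) ->
  (\sum_(k < T) (1 - sigma) ^+ k) *
    (potential rho a c (b T) - potential rho a c y) <=
  (1 - sigma) ^+ T *
    \sum_i (fine (rho i))^-1 * KL (row i y) (row i (b 0%N)).
Proof.
move=> rho0 /andP[sigma0 sigma1] sigma_le.
have rhoE i : exists2 r, rho i = r%:E & 0 < r.
  case: (rho i) (rho0 i) (rhoy i) => [r| |] //.
  by rewrite lte_fin => r0 _; exists r.
have r0 i : 0 < fine (rho i) by have [r ->] := rhoE i.
have rN i : (rho i == -oo%E) = false by have [r ->] := rhoE i.
pose alpha i := (1 - fine (rho i)) / fine (rho i).
pose beta i := (fine (rho i))^-1.
pose g := \matrix_(i, j) ((fine (rho i))^-1 * ln (a i j)).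
have beta0 i : 0 <= beta i by rewrite invr_ge0 ltW.
have potE z : spending_matrix e z ->
    potential rho a c z = mirror_objective alpha g 1 z.
  move=> [z0 _]; rewrite potentialE// -sumrN; apply: eq_bigr => i _.
  rewrite -sumrN; apply: eq_bigr => j _.
  rewrite rN /mirror_gradient /alpha [g i j]mxE; field.
  by rewrite gt_eqF.
rewrite !potE//; last exact: bid_spending.
apply: (@mirror_descent_rate _ _ _ e) => //.
- exact: bid_spending.
- exact: bid_gt0.
- move=> t; rewrite b_update; apply: mirror_step_bid_update => [|i j].
    exact: bid_gt0.
  have w0 := bid_gt0 t i j; have p0 := prices_ord_gt0 i j (bid_gt0 t).
  rewrite /bid_weight /mirror_gradient /alpha /beta [g i j]mxE.
  have [r rE r1] := rhoE i; rewrite rE /= r1.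
  rewrite lnM ?posrE ?powR_gt0 ?divr_gt0// ln_powR ln_div ?posrE//; field.
  by rewrite gt_eqF.
- move=> z w ze we w0; have [z0 _] := ze.
  have Kp := KL_prices_ge0 ze we w0; have Ks := KL_prices_le z0 w0.
  rewrite /mirror_divergence /mirror_distance mul1r; apply/andP; split.
    rewrite mulr_sumr -[leLHS]addr0; apply: lerD => //.
    apply: ler_sum => i _; rewrite mulrA; apply: ler_wpM2r.
      exact: KL_row_ge0 ze we w0.
    exact: ler_wpM2r (beta0 i) _ _ (sigma_le i).
  apply: le_trans (lerD (lexx _) Ks) _; rewrite -big_split.
  apply: ler_sum => i _ /=; rewrite /alpha /beta.
  rewrite le_eqVlt; apply/orP; left; apply/eqP; field.
  by rewrite gt_eqF.
Qed.

(** Here the objective is minus the potential, [s = -1] and both row weights are [complement_coef].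
    The two price bounds swap roles: nonnegativity gives smoothness, and the log-sum bound costs 1
    per row weight in the convexity estimate. *)
Lemma complements_rate (sigma : R) (T : nat) : (forall i, (rho i < 0)%E) ->
  0 <= sigma <= 1 ->
  (forall i, sigma * complement_coef (rho i) <= complement_coef (rho i) - 1) ->
  (\sum_(k < T) (1 - sigma) ^+ k) *
    (potential rho a c y - potential rho a c (b T)) <=
  (1 - sigma) ^+ T *
    \sum_i complement_coef (rho i) * KL (row i y) (row i (b 0%N)).
Proof.
move=> rho0 /andP[sigma0 sigma1] sigma_le.
pose beta i := complement_coef (rho i).
pose g := \matrix_(i, j) (if rho i == -oo%E then ln (c i j)
                          else - ((fine (rho i))^-1 * ln (a i j))).
have beta0 i : 0 <= beta i.
  rewrite /beta /complement_coef; case: (rho i) (rho0 i) => [r| |] //=.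
  by rewrite lte_fin => r0; rewrite -mulrNN mulr_ge0 ?oppr_ge0 ?invr_le0; lra.
have potE z : spending_matrix e z ->
    potential rho a c z = - mirror_objective beta g (-1) z.
  move=> [z0 _]; rewrite potentialE//; congr (- _); apply: eq_bigr => i _.
  apply: eq_bigr => j _; rewrite /mirror_gradient /beta [g i j]mxE.
  congr (_ * _); case: (rho i) (rho0 i) => [r| |] //=; last first.
    by move=> _; rewrite mul1r mulN1r.
  by rewrite lte_fin => r0; field; rewrite lt_eqF.
rewrite !potE//; last exact: bid_spending.
rewrite opprK [X in _ * X <= _]addrC.
apply: (@mirror_descent_rate _ _ _ e) => //.
- exact: bid_spending.
- exact: bid_gt0.
- move=> t; rewrite b_update; apply: mirror_step_bid_update => [|i j].
    exact: bid_gt0.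
  have w0 := bid_gt0 t i j; have p0 := prices_ord_gt0 i j (bid_gt0 t).
  rewrite /bid_weight /mirror_gradient /beta [g i j]mxE.
  case: (rho i) (rho0 i) => [r| |] //=; last first.
    by move=> _; rewrite lnM ?posrE//; ring.
  rewrite lte_fin => r0; rewrite ltNge (ltW r0)/=.
  rewrite ln_powR ln_div ?posrE ?powR_gt0// ln_powR; field.
  by rewrite lt_eqF//= gt_eqF// subr_gt0 (lt_trans r0).
- move=> z w ze we w0; have [z0 _] := ze.
  have Kp := KL_prices_ge0 ze we w0; have Ks := KL_prices_le z0 w0.
  rewrite /mirror_divergence /mirror_distance mulN1r; apply/andP; split.
    move: Ks; rewrite -lerN2 => Ks; apply: le_trans (lerD (lexx _) Ks).
    rewrite mulr_sumr -sumrB; apply: ler_sum => i _.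
    have := ler_wpM2r (KL_row_ge0 i ze we w0) (sigma_le i).
    by rewrite mulrBl mul1r mulrA.
  by rewrite gerBl.
Qed.

End Trajectory.
End BidDynamics.

(* The minima sigma range over numbers smaller than 1, so that 1 is a neutral
   element. *)
Theorem theorem3p3 (R : realType) (m n : nat) (e : 'I_m -> R)
    (rho : 'I_m -> \bar R) (a c : 'M[R]_(m, n))
    (e_gt0 : forall i, 0 < e i)
    (rho_le1 : forall i, (rho i <= 1)%E)
    (rho_neq0 : forall i, rho i != 0%E)
    (a_gt0 : forall i j, 0 < a i j)
    (c_gt0 : forall i j, 0 < c i j)
    (b : nat -> 'M[R]_(m, n))
    (b0_spending : spending_matrix e (b 0%N))
    (b0_gt0 : forall i j, 0 < b 0%N i j)
    (b_update : forall t, b t.+1 = bid_update e rho a c (b t))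
    (bstar : 'M[R]_(m, n))
    (bstar_eq : equilibrium_spending e rho a c bstar)
    (T : nat) (T_ge1 : (1 <= T)%N) :
  [/\ (forall i, (0 < rho i)%E) ->
      potential rho a c (b T) - potential rho a c bstar <=
        T%:R^-1 *
        \sum_i (fine (rho i))^-1 * KL (row i bstar) (row i (b 0%N)),

      (forall i, (0 < rho i < 1)%E) ->
      let sigma := \big[Order.min/1]_(i < m) (1 - fine (rho i)) in
      potential rho a c (b T) - potential rho a c bstar <=
        sigma * (1 - sigma) ^+ T / (1 - (1 - sigma) ^+ T) *
        \sum_i (fine (rho i))^-1 * KL (row i bstar) (row i (b 0%N)),

      (forall i, (rho i < 0)%E) ->
      potential rho a c bstar - potential rho a c (b T) <=
        T%:R^-1 *
        \sum_i complement_coef (rho i) * KL (row i bstar) (row i (b 0%N)) &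

      (forall i, (-oo < rho i < 0)%E) ->
      let sigma := \big[Order.min/1]_(i < m) (1 - fine (rho i))^-1 in
      potential rho a c bstar - potential rho a c (b T) <=
        sigma * (1 - sigma) ^+ T / (1 - (1 - sigma) ^+ T) *
        \sum_i complement_coef (rho i) * KL (row i bstar) (row i (b 0%N))].
Proof.
have rhoy i : rho i != +oo%E by case: (rho i) (rho_le1 i).
(* Without buyers every sum is empty and both sides are 0. Otherwise a positive budget, being a row
   sum, forces at least one good to exist. *)
case: m => [|m'] in e rho a c e_gt0 rho_le1 rho_neq0 a_gt0 c_gt0 b b0_spending
  b0_gt0 b_update bstar bstar_eq rhoy *.
  have pot0 y : potential rho a c y = 0 by rewrite /potential !big_ord0 oppr0 addr0.
  by rewrite /= !pot0 !big_ord0 !mulr0 subrr.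
have n0 : (0 < n)%N.
  rewrite lt0n; apply/eqP => n0; have [_ /(_ ord0)] := b0_spending.
  rewrite big1 => [e0|[j jn] _]; first by have := e_gt0 ord0; rewrite -e0 ltxx.
  by exfalso; move: jn; rewrite n0.
have ye := equilibrium_spending_matrix n0 e_gt0 rho_neq0 rhoy a_gt0 c_gt0 bstar_eq.
split=> rho0; cbv zeta.
- apply: sublinear_rate => //.
  apply: (substitutes_rate n0 e_gt0) => // [|i]; first by rewrite lexx ler01.
  case: (rho i) (rho0 i) (rho_le1 i) => [r| |] //= _.
  by rewrite lee_fin subr_ge0.
- set sigma := \big[_/_]_i _; have sigmaP : 0 < sigma <= 1.
    rewrite bigmin_le_id andbT; apply: lt_bigmin => // i _.
    case: (rho i) (rho0 i) => [r| |] //= /andP[_].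
    by rewrite lte_fin subr_gt0.
  apply: linear_rate => //; case/andP: sigmaP => sigma0 sigma1.
  apply: (substitutes_rate n0 e_gt0) => // [i||i].
  + by case/andP: (rho0 i).
  + by rewrite ltW.
  + exact: bigmin_le.
- apply: sublinear_rate => //.
  apply: (complements_rate n0 e_gt0) => // [|i]; first by rewrite lexx ler01.
  (* The excess of the coefficient over 1 is -1/r > 0 for finite r and exactly 0 for Leontief
     buyers. *)
  rewrite mul0r /complement_coef.
  case: (rho i) (rho0 i) => [r| |] /=; rewrite ?subrr//.
  rewrite lte_fin => r0; have -> : (r - 1) / r - 1 = - r^-1.
    by field; rewrite lt_eqF.
  by rewrite oppr_ge0 invr_le0 ltW.
- have r0 i : (rho i < 0)%E by case/andP: (rho0 i).
  set sigma := \big[_/_]_i _; have sigmaP : 0 < sigma <= 1.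
    rewrite bigmin_le_id andbT; apply: lt_bigmin => // i _.
    case: (rho i) (rho0 i) => [r| |] //= /andP[_].
    by rewrite lte_fin invr_gt0 => ?; lra.
  apply: linear_rate => //; case/andP: sigmaP => sigma0 sigma1.
  apply: (complements_rate n0 e_gt0) => // [|i]; first by rewrite ltW.
  have : sigma <= (1 - fine (rho i))^-1 by exact: bigmin_le.
  rewrite /complement_coef.
  case: (rho i) (rho0 i) => [r| |] //=.
  rewrite !lte_fin => /andP[_ ri0] sle.
  (* The excess over 1 is the fraction 1/(1 - r) of the coefficient, which is where this [sigma]
     comes from. *)
  have -> : (r - 1) / r - 1 = (1 - r)^-1 * ((r - 1) / r).
    by field; rewrite lt_eqF//= gt_eqF//; lra.
  by rewrite ler_wpM2r// -mulrNN mulr_ge0 ?oppr_ge0 ?invr_le0; lra.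
Qed.
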